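(* Let $n, \ell \geq 1$ be integers, let $U \subseteq \mathbb{R}^n$ be open, and let $f: U \to \mathbb{R}$ be positive homogeneous of degree $1$ and have continuous partial derivatives of order $\ell$ in $U$ (i.e. $f$ is $\ell$-times continuously differentiable in $U$). Let $a, b \in U$ be such that the line segment connecting $a$ and $b$ lies in $U$. Then, for all integers $m$ with $1 \leq m \leq \ell$, $$T^{(m)} f^m(a; b-a) = \frac{1}{m!}\, d^m f^m(a; b),$$ where $f^m$ denotes the pointwise $m$-th power $x \mapsto f(x)^m$.
   Context: Positive homogeneity: a function $f: U \to \mathbb{R}$ on an open set $U \subseteq \mathbb{R}^n$ is positive homogeneous of degree $1$ if $f(\lambda x) = \lambda f(x)$ for all $x \in U$ and all $\lambda > 0$ with $\lambda x \in U$. Higher derivatives: for a function $g: U \to \mathbb{R}$ that is $j$-times continuously differentiable ($j \geq 1$), $x \in U$ and $t = (t_1,\ldots,t_n) \in \mathbb{R}^n$, $$d^j g(x; t) = \sum_{k \in \{1,\ldots,n\}^j} D_k g(x)\, t_{k_1} \cdots t_{k_j},$$ where for $k = (k_1,\ldots,k_j)$, $D_k g = \frac{\partial^j g}{\partial x_{k_1} \cdots \partial x_{k_j}}$ is the iterated partial derivative. Taylor polynomial: for $g$ with continuous partial derivatives of order $m$ in $U$, and $a,b \in U$ with the segment from $a$ to $b$ contained in $U$, $$T^{(m)} g(a; b-a) = g(a) + \sum_{k=1}^m \frac{1}{k!}\, d^k g(a; b-a).$$ In the claim these notions are applied to $g = f^m$. *)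

(* Defs.v *)
(* MathComp-Analysis; R^n is 'rV[R]_n for R : realType. *)
From mathcomp Require Import all_boot all_order all_algebra.
From mathcomp Require Import all_classical all_reals all_analysis.

Set Implicit Arguments.
Unset Strict Implicit.
Unset Printing Implicit Defensive.

Import Order.TTheory GRing.Theory Num.Theory.
Import numFieldNormedType.Exports.

Local Open Scope classical_set_scope.
Local Open Scope ring_scope.

(* A function on an open set U is represented by a total function on 'rV[R]_n
   whose values outside U are arbitrary: no definition below constrains them,
   and partial derivatives at a point of the open set U do not depend on them. *)

Section Defs.
Variables (R : realType) (n : nat).
Implicit Types (U : set 'rV[R]_n) (g : 'rV[R]_n -> R) (x t a b : 'rV[R]_n).

Definition pos_homogeneous1 U g : Prop :=
  forall (x : 'rV[R]_n) (lambda : R),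
    U x -> 0 < lambda -> U (lambda *: x) -> g (lambda *: x) = lambda * g x.

(* The partial derivative is a [lim], which is meaningful only where
   [derivable g x (delta_mx 0 i)] holds. *)
Definition partial (i : 'I_n) g : 'rV[R]_n -> R :=
  fun x => 'D_(delta_mx 0 i) (g : 'rV[R]_n -> R^o) x.

(* For k = [:: k_1; ...; k_j], the last index is differentiated first. *)
Definition iter_partial (k : seq 'I_n) g : 'rV[R]_n -> R := foldr partial g k.

Definition cont_diff (l : nat) U g : Prop :=
  (forall (k : seq 'I_n) (i : 'I_n) x, (size k < l)%N -> U x ->
     derivable (iter_partial k g : 'rV[R]_n -> R^o) x (delta_mx 0 i)) /\
  (forall (k : seq 'I_n) x, (size k <= l)%N -> U x ->
     {for x, continuous (iter_partial k g)}).

Definition higher_diff (j : nat) g x t : R :=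
  \sum_(k : j.-tuple 'I_n)
    iter_partial k g x * \prod_(i < j) t ord0 (tnth k i).

(* [taylor m g a h] is the Taylor polynomial at a with increment h, i.e.
   T^(m) g (a; h). *)
Definition taylor (m : nat) g a h : R :=
  g a + \sum_(1 <= k < m.+1) (k`!)%:R^-1 * higher_diff k g a h.

End Defs.

(* Main.v *)
(* The m-th power F of f is homogeneous of degree m.  Put h = b - a and, along the
   line x(t) = a + t b, let A_k = d^k F(x(t); b) and G_j = d^j F(x(t); h).  As
   (1 + t) b = x(t) + h, Euler's relation for d^j F(.; h), which is homogeneous of
   degree m - j, gives (1 + t) G_j' = (m - j) G_j + G_{j+1}, while A_k' = A_{k+1}.
   By induction on k, (1 + t)^k A_k = \sum_j 'C(m - j, k - j) k!/j! G_j, and the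
   theorem is the case k = m, t = 0.  The symmetry of higher partial derivatives is
   not needed. *)
Require Import Defs.
From mathcomp Require Import all_boot all_order all_algebra.
From mathcomp Require Import all_classical all_reals all_analysis.
From mathcomp Require Import ring lra zify.
Import Order.TTheory GRing.Theory Num.Theory.
Import numFieldNormedType.Exports.
Local Open Scope classical_set_scope.
Local Open Scope ring_scope.

(** * Directional derivatives, and a strict form of them that is linear in the direction *)

Section DirectionalDerivative.
Set Implicit Arguments.
Unset Strict Implicit.
Unset Printing Implicit Defensive.
Variables (R : realType) (V : normedModType R).
Implicit Types (g : V -> R^o) (x v w : V) (L M : R).

(** The two difference quotients are the same function of the step. This moves between derivatives
    along a line and derivatives in one real variable, where the mean value theorem and the product
    rule are at hand. *)
Lemma is_derive_line g (a v : V) (t L : R) :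
  is_derive t (1 : R) (fun s : R => g (a + s *: v)) L <->
  is_derive (a + t *: v) v g L.
Proof.
have E : (fun h : R => h^-1 *: (((fun s : R => g (a + s *: v)) \o shift t) (h *: (1 : R)) -
      g (a + t *: v))) =
   (fun h : R => h^-1 *: ((g \o shift (a + t *: v)) (h *: v) - g (a + t *: v))).
  apply/funext => h /=; congr (_ *: (g _ - _)).
  by rewrite [h%:A]mulr1 scalerDl addrCA.
by split=> -[]; rewrite /derivable /derive => d1 d2; apply: DeriveDef;
  rewrite /derivable /derive; [rewrite -E|rewrite -E|rewrite E|rewrite E].
Qed.

Lemma cvg_line0 x v : p.1 + p.2 *: v @[p --> (x, 0 : R)] --> x.
Proof.
rewrite -[X in _ --> X]addr0 -(scale0r v).
by apply: cvgD; [exact: cvg_fst|apply: cvgZr_tmp; exact: cvg_snd].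
Qed.

(* Letting the base point vary makes the derivative additive in [v]. *)
Definition strict_derive g x v L := forall e : R, 0 < e ->
  \forall p \near (x, 0 : R),
    `|g (p.1 + p.2 *: v) - g p.1 - p.2 * L| <= e * `|p.2|.

Lemma strict_derive0 g x : strict_derive g x 0 0.
Proof.
move=> e e0; near=> p; rewrite scaler0 addr0 subrr mulr0 subrr normr0.
by rewrite mulr_ge0 // ltW.
Unshelve. all: by end_near. Qed.

(** A step along [v + w] is a step along [w] from [y] followed by a step along [v] from
    [y + h *: w]. The intermediate point still tends to [x], so the estimate for [v] applies there
    with its moving base point. *)
Lemma strict_deriveD g x v w L M : strict_derive g x v L ->
  strict_derive g x w M -> strict_derive g x (v + w) (L + M).
Proof.
move=> gv gw e e0; have e20 : 0 < e / 2 by rewrite divr_gt0.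
have cw : (fun p : V * R => (p.1 + p.2 *: w, p.2)) p @[p --> (x, 0 : R)]
    --> (x, 0 : R).
  by apply: (@cvg_pair _ _ _ _ (nbhs _) (nbhs _)); [exact: cvg_line0|exact: cvg_snd].
have := cw _ (gv _ e20); have := gw _ e20.
rewrite /nbhs /=.
apply: filterS2 => p /= H1 H2.
have -> : g (p.1 + p.2 *: (v + w)) - g p.1 - p.2 * (L + M) =
  (g (p.1 + p.2 *: w + p.2 *: v) - g (p.1 + p.2 *: w) - p.2 * L) +
  (g (p.1 + p.2 *: w) - g p.1 - p.2 * M).
  by rewrite scalerDr addrCA addrC; ring.
rewrite (le_trans (ler_normD _ _))// (le_trans (lerD H2 H1))//.
by rewrite -mulrDl -splitr.
Qed.

Lemma strict_deriveZ g x v L (c : R) :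
  strict_derive g x v L -> strict_derive g x (c *: v) (c * L).
Proof.
move=> gv e e0; have c0 : 0 < `|c| + 1 by rewrite ltr_wpDl.
have cw : (fun p : V * R => (p.1, p.2 * c)) p @[p --> (x, 0 : R)]
    --> (x, 0 : R).
  apply: (@cvg_pair _ _ _ _ (nbhs _) (nbhs _)) => /=; first exact: cvg_fst.
  suff : p.2 * c @[p --> (x, 0 : R)] --> 0 * c by rewrite mul0r.
  by apply: cvgMr_tmp; exact: cvg_snd.
have := cw _ (gv _ (divr_gt0 e0 c0)); rewrite /nbhs /=.
apply: filterS => p /=; rewrite scalerA mulrA => /le_trans; apply.
rewrite normrM [X in X <= _](_ : _ = e * `|p.2| * (`|c| / (`|c| + 1))); last by ring.
rewrite ler_piMr//; first by rewrite mulr_ge0// ltW.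
by rewrite ler_pdivrMr// mul1r lerDl.
Qed.

Lemma strict_derive_is_derive g x v L : strict_derive g x v L -> is_derive x v g L.
Proof.
move=> gv.
have cvL : (fun h : R => h^-1 *: ((g \o shift x) (h *: v) - g x)) @ 0^' --> (L : R^o).
  apply/cvgrPdist_le => e e0.
  have cx : (x, h : R) @[h --> (0 : R)] --> (x, 0 : R).
    by apply: (@cvg_pair _ _ _ _ (nbhs _) (nbhs _)) => /=; [exact: cvg_cst|exact: cvg_id].
  have H0 : \forall h \near (0 : R), `|g (x + h *: v) - g x - h * L| <= e * `|h|.
    exact: cx _ (gv _ e0).
  have H : \forall h \near 0^', `|g (x + h *: v) - g x - h * L| <= e * `|h|.
    exact: cvg_within H0.
  near=> h.
  have h0 : h != 0 by near: h; exact: nbhs_dnbhs_neq.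
  rewrite /= (addrC _ x).
  have -> : (L : R) - h^-1 *: (g (x + h *: v) - g x) =
     - h^-1 * (g (x + h *: v) - g x - h * L).
    by rewrite /GRing.scale /=; field.
  rewrite normrM normrN normfV ler_pdivrMl ?normr_gt0// [leRHS]mulrC.
  by near: h.
apply: DeriveDef; first by apply/cvg_ex; exists L.
exact: (cvg_lim _ cvL).
Unshelve. all: by end_near. Qed.

(** By the mean value theorem the increment over a short segment is its length times [dg] at a point
    of the segment, and continuity makes that value close to [dg x] for all base points near [x] at
    once. *)
Lemma strict_derive_C1 (U : set V) g (dg : V -> R) x v : open U -> U x ->
  (forall y, U y -> is_derive y v g (dg y)) ->
  {for x, continuous dg} -> strict_derive g x v (dg x).
Proof.
move=> oU Ux gdg cdg e e0.
have H : \forall p \near (x, 0 : R), U (p.1 + p.2 *: v) /\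
    `|dg x - dg (p.1 + p.2 *: v)| <= e.
  apply: (@cvg_line0 x v [set y | U y /\ `|dg x - dg y| <= e]).
  apply: filterI; first exact: open_nbhs_nbhs.
  by move/cvgrPdist_le : cdg; exact.
case: H => -[A B] /= [Ax /nbhs_ballP[d /= d0 dB]] AB.
exists (A, ball (0 : R) d) => /=; first by split=> //; exact: nbhsx_ballx.
move=> [y h] /= [Ay]; rewrite /ball /= sub0r normrN => hd.
(* The ball in the step variable is symmetric, so it contains every [s] no larger than [h] in
   absolute value: the whole segment is controlled. *)
have AB' s : `|s| <= `|h| -> U (y + s *: v) /\ `|dg x - dg (y + s *: v)| <= e.
  move=> sh; apply: (AB (y, s)); split=> //=; apply: dB.
  by rewrite /ball /= sub0r normrN (le_lt_trans sh).
pose phi (s : R) := g (y + s *: v).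
have dphi s : `|s| <= `|h| -> is_derive s (1 : R) phi (dg (y + s *: v)).
  by move=> /AB'[Us _]; apply/is_derive_line/gdg.
(* Arbitrary endpoints [u <= w] serve both signs of [h]: the interval is [[0, h]] or [[h, 0]]. *)
have mvt (u w : R) : `|u| <= `|h| -> `|w| <= `|h| -> u <= w ->
    `|phi w - phi u - (w - u) * dg x| <= e * (w - u).
  move=> uh wh uw.
  have bd s : s \in `[u, w] -> `|s| <= `|h|.
    move: uh wh; rewrite !ler_norml in_itv/= => /andP[? ?] /andP[? ?] /andP[? ?].
    by apply/andP; split; lra.
  have [c cuw ->] : exists2 c, c \in `[u, w] &
      phi w - phi u = dg (y + c *: v) * (w - u).
    apply: (@MVT_segment _ phi (fun c => dg (y + c *: v))) => //.
      by move=> s suw; apply: dphi; apply: bd; apply: subset_itv_oo_cc suw.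
    apply: derivable_within_continuous => s suw.
    by have [] := dphi _ (bd _ suw).
  have -> : dg (y + c *: v) * (w - u) - (w - u) * dg x =
      - ((dg x - dg (y + c *: v)) * (w - u)) by ring.
  rewrite normrN normrM (ger0_norm (_ : 0 <= w - u)) ?subr_ge0//.
  by rewrite ler_wpM2r ?subr_ge0//; have [] := AB' c (bd _ cuw).
have phi0 : phi 0 = g y by rewrite /phi scale0r addr0.
have [h0|h0] := leP 0 h.
  have := mvt 0 h; rewrite normr0 lexx normr_ge0 phi0 subr0 => /(_ isT isT h0).
  by rewrite (ger0_norm h0).
have := mvt h 0; rewrite normr0 lexx normr_ge0 phi0 sub0r => /(_ isT isT (ltW h0)).
rewrite (ltr0_norm h0) -normrN; congr (`|_| <= _).
by rewrite /phi; ring.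
Qed.

End DirectionalDerivative.

(** * Functions of class C^l on an open set: closure properties and directional derivatives *)

Section ContDiff.
Set Implicit Arguments.
Unset Strict Implicit.
Unset Printing Implicit Defensive.
Variables (R : realType) (n : nat) (U : set 'rV[R]_n).
Hypothesis oU : open U.
Implicit Types (f g : 'rV[R]_n -> R) (x t v : 'rV[R]_n) (l : nat).

Lemma near_eq_open f g x : (forall y, U y -> f y = g y) -> U x ->
  {near x, f =1 g}.
Proof. by move=> fg Ux; near=> y; apply: fg; near: y; exact: open_nbhs_nbhs.
Unshelve. all: by end_near. Qed.

Lemma cont_diff0P g : cont_diff 0 U g <-> forall x, U x -> {for x, continuous g}.
Proof.
split=> [[_ cg] x Ux|cg]; first exact: (cg [::]).
by split=> // -[|//] x _; exact: cg.
Qed.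

(** Peels off the derivative taken first, which is the last index of the sequence, hence [rcons].
    The closure properties below follow by induction on [l] through this equivalence. *)
Lemma cont_diffSP l g : cont_diff l.+1 U g <->
  [/\ forall x, U x -> {for x, continuous g},
      forall i x, U x -> derivable (g : _ -> R^o) x (delta_mx 0 i) &
      forall i, cont_diff l U (partial i g)].
Proof.
split=> [[dg cg]|[cg dg pg]].
  split=> [x Ux|i x Ux|i]; [exact: (cg [::])|exact: (dg [::])|].
  split=> [k i' x kl Ux|k x kl Ux].
    by have := dg (rcons k i) i' x; rewrite /iter_partial foldr_rcons size_rcons; exact.
  by have := cg (rcons k i) x; rewrite /iter_partial foldr_rcons size_rcons; exact.
split=> [k i x|k x]; case: (lastP k) => [|k' i'].
- by move=> _; exact: dg.
- by rewrite /iter_partial foldr_rcons size_rcons; exact: (pg i').1.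
- by move=> _; exact: cg.
- by rewrite /iter_partial foldr_rcons size_rcons; exact: (pg i').2.
Qed.

Lemma eq_partial f g i : (forall x, U x -> f x = g x) ->
  forall x, U x -> partial i f x = partial i g x.
Proof. move=> fg x Ux; apply: near_eq_derive; exact: near_eq_open. Qed.

(** On an open set, agreement on [U] is agreement near each of its points, so it passes to partial
    derivatives. The sum and product rules for [partial] are only available on [U], so their use
    goes through this lemma. *)
Lemma eq_cont_diff l f g : (forall x, U x -> f x = g x) ->
  cont_diff l U f -> cont_diff l U g.
Proof.
have ceq f' g' : (forall x, U x -> f' x = g' x) ->
    (forall x, U x -> {for x, continuous f'}) ->
    (forall x, U x -> {for x, continuous g'}).
  move=> fg cf x Ux; rewrite /prop_for /continuous_at -(fg x Ux).
  have gf := near_eq_open fg Ux.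
  exact: cvg_trans (near_eq_cvg gf) (cf x Ux).
elim: l f g => [|l IH] f g fg.
  by move=> /cont_diff0P cf; apply/cont_diff0P; exact: ceq cf.
move=> /cont_diffSP[cf df pf]; apply/cont_diffSP; split=> [|i x Ux|i].
- exact: ceq cf.
- by apply: near_eq_derivable (df i x Ux); exact: near_eq_open.
- by apply: IH (pf i); exact: eq_partial.
Qed.

Lemma cont_diff_leq l l' g : (l' <= l)%N -> cont_diff l U g -> cont_diff l' U g.
Proof.
move=> ll [dg cg]; split=> [k i x kl|k x kl].
  by apply: dg; exact: leq_trans ll.
by apply: cg; exact: leq_trans ll.
Qed.

Lemma cont_diff_iter_partial l k g :
  cont_diff (size k + l) U g -> cont_diff l U (iter_partial k g).
Proof.
move=> [dg cg]; split=> [k' i x kl|k' x kl];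
  rewrite /iter_partial -foldr_cat.
  by apply: dg; rewrite size_cat addnC ltn_add2l.
by apply: cg; rewrite size_cat addnC leq_add2l.
Qed.

Lemma cont_diffD l f g :
  cont_diff l U f -> cont_diff l U g -> cont_diff l U (fun x => f x + g x).
Proof.
elim: l f g => [|l IH] f g.
  move=> /cont_diff0P cf /cont_diff0P cg; apply/cont_diff0P => x Ux.
  exact: (cvgD (cf _ Ux) (cg _ Ux)).
move=> /cont_diffSP[cf df pf] /cont_diffSP[cg dg pg].
apply/cont_diffSP; split=> [x Ux|i x Ux|i].
- exact: (cvgD (cf _ Ux) (cg _ Ux)).
- by apply: derivableD; [exact: df|exact: dg].
- apply: eq_cont_diff (IH _ _ (pf i) (pg i)) => x Ux.
  by rewrite /partial -deriveD //; [exact: df|exact: dg].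
Qed.

Lemma cont_diffM l f g :
  cont_diff l U f -> cont_diff l U g -> cont_diff l U (fun x => f x * g x).
Proof.
elim: l f g => [|l IH] f g.
  move=> /cont_diff0P cf /cont_diff0P cg; apply/cont_diff0P => x Ux.
  exact: (cvgM (cf _ Ux) (cg _ Ux)).
move=> cf' cg'.
have [cf df pf] := (cont_diffSP _ _).1 cf'; have [cg dg pg] := (cont_diffSP _ _).1 cg'.
apply/cont_diffSP; split=> [x Ux|i x Ux|i].
- exact: (cvgM (cf _ Ux) (cg _ Ux)).
- by apply: derivableM; [exact: df|exact: dg].
(* Leibniz rule: the undifferentiated factors are lowered to class [l] so that the induction
   hypothesis covers both products. *)
- apply: eq_cont_diff (cont_diffD
    (IH _ _ (cont_diff_leq (leqnSn l) cf') (pg i))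
    (IH _ _ (cont_diff_leq (leqnSn l) cg') (pf i))) => x Ux.
  by rewrite /partial [RHS]deriveM //; [exact: df|exact: dg].
Qed.

Lemma cont_diff_cst l (c : R) : cont_diff l U (fun=> c).
Proof.
elim: l c => [|l IH] c; first by apply/cont_diff0P => x _; exact: cst_continuous.
apply/cont_diffSP; split=> [x _|i x _|i]; [exact: cst_continuous|exact: derivable_cst|].
by apply: eq_cont_diff (IH 0) => x _; rewrite /partial derive_cst.
Qed.

Lemma cont_diffX l f m : cont_diff l U f -> cont_diff l U (fun x => f x ^+ m).
Proof.
move=> cf; elim: m => [|m IH].
  by apply: eq_cont_diff (cont_diff_cst l 1) => x _; rewrite expr0.
by apply: eq_cont_diff (cont_diffM cf IH) => x _; rewrite exprS.
Qed.

(** Continuity makes the partial derivatives strict, and strict derivatives add and scale;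
    decomposing [v] in the standard basis then gives every direction. *)
Lemma cont_diff1_is_derive g x v : cont_diff 1 U g -> U x ->
  is_derive x v (g : _ -> R^o) (\sum_i v ord0 i * partial i g x).
Proof.
move=> /cont_diffSP[_ dg pg] Ux; apply: strict_derive_is_derive.
have {1}-> : v = \sum_i v ord0 i *: delta_mx 0 i by exact: row_sum_delta.
apply: (big_ind2 (fun w L => strict_derive g x w L)) => [|w L w' L'|i _].
- exact: strict_derive0.
- exact: strict_deriveD.
- apply: strict_deriveZ; apply: (@strict_derive_C1 _ _ U) => //.
    by move=> y Uy; apply: derivableP; exact: dg.
  by move/cont_diff0P : (pg i); exact.
Qed.

Lemma higher_diff0 g x t : higher_diff 0 g x t = g x.
Proof.
rewrite /higher_diff (big_pred1 [tuple]) => [|k]; last by rewrite /= [k]tuple0; apply/esym/eqP.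
by rewrite big_ord0 mulr1.
Qed.

(** The head index is the outermost derivative. Isolating it exhibits the derivative of
    [higher_diff j g ^~ t] in the direction [t]. *)
Lemma higher_diffS j g x t : higher_diff j.+1 g x t =
  \sum_i t ord0 i * \sum_(k : j.-tuple 'I_n)
    iter_partial (i :: k) g x * \prod_(q < j) t ord0 (tnth k q).
Proof.
rewrite /higher_diff (reindex (fun p : 'I_n * j.-tuple 'I_n => [tuple of p.1 :: p.2])) /=.
  rewrite -(pair_bigA _ (fun i (k : j.-tuple 'I_n) =>
    iter_partial (i :: k) g x * \prod_(q < j.+1) t ord0 (tnth [tuple of i :: k] q))) /=.
  apply: eq_bigr => i _; rewrite big_distrr /=; apply: eq_bigr => k _.
  rewrite big_ord_recl tnth0 mulrCA; congr (_ * (_ * _)).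
  by apply: eq_bigr => q _; rewrite tnthS.
exists (fun k => (thead k, [tuple of behead k])) => [[i k] _|k _] /=.
  by rewrite theadE; congr (_, _); apply: val_inj.
by rewrite [RHS]tuple_eta.
Qed.

(** For fixed [t] the monomials in [t] are constants, so only the iterated partials are
    differentiated. The direction [v] is independent of [t]: it is later taken to be [b] and the
    base point itself. *)
Lemma higher_diff_is_derive j g x t v : cont_diff j.+1 U g -> U x ->
  is_derive x v (fun y => higher_diff j g y t : R^o)
    (\sum_i v ord0 i * \sum_(k : j.-tuple 'I_n)
       iter_partial (i :: k) g x * \prod_(q < j) t ord0 (tnth k q)).
Proof.
move=> cg Ux.
have -> : (fun y => higher_diff j g y t : R^o) =
    \sum_(k : j.-tuple 'I_n)
      ((\prod_(q < j) t ord0 (tnth k q)) \*: (iter_partial k g : _ -> R^o)).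
  apply/funext => y; rewrite fct_sumE; apply: eq_bigr => k _.
  by rewrite /= mulrC.
have -> : \sum_i v ord0 i * (\sum_(k : j.-tuple 'I_n)
       iter_partial (i :: k) g x * \prod_(q < j) t ord0 (tnth k q)) =
    \sum_(k : j.-tuple 'I_n) (\prod_(q < j) t ord0 (tnth k q)) *:
      (\sum_i v ord0 i * partial i (iter_partial k g) x : R^o).
  under eq_bigr do rewrite big_distrr /=.
  rewrite exchange_big /=; apply: eq_bigr => k _.
  rewrite scaler_sumr; apply: eq_bigr => i _.
  by rewrite /GRing.scale /=; ring.
apply: (big_ind2 (fun (w : 'rV[R]_n -> R^o) (L : R^o) => is_derive x v w L)).
- exact: is_derive_cst.
- by move=> *; exact: is_deriveD.
- move=> k _; apply: is_deriveZ; apply: cont_diff1_is_derive => //.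
  by apply: cont_diff_iter_partial; rewrite size_tuple addn1.
Qed.

(** * Homogeneous functions and Euler's relation *)

Definition homogeneous d g := forall x (lambda : R),
  U x -> 0 < lambda -> U (lambda *: x) -> g (lambda *: x) = lambda ^+ d * g x.

Lemma homogeneousX f m : pos_homogeneous1 U f -> homogeneous m (fun x => f x ^+ m).
Proof. by move=> hf x c Ux c0 Ucx; rewrite hf// exprMn. Qed.

(** The map [y |-> g (c *: y)] has two derivatives along the i-th basis vector, one from the chain
    rule and one from homogeneity; equate them and cancel a factor [c]. *)
Lemma homogeneous_partial d g i : cont_diff 1 U g ->
  homogeneous d.+1 g -> homogeneous d (partial i g).
Proof.
move=> cg hg x c Ux c0 Ucx.
have dgc : is_derive x (delta_mx 0 i) (fun y => g (c *: y) : R^o)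
    (c * partial i g (c *: x)).
  have [] : is_derive (c *: x) (c *: delta_mx 0 i) (g : _ -> R^o)
      (c * partial i g (c *: x)).
    have := cont_diff1_is_derive (c *: delta_mx 0 i) cg Ucx.
    rewrite (bigD1 i) //= big1 ?addr0 => [|i' ii']; first by rewrite !mxE !eqxx mulr1.
    by rewrite !mxE (negbTE ii') andbF mulr0 mul0r.
  (* The chain rule for a scaling: moving [x] by [h e_i] moves [c *: x] by [h (c e_i)], so the
     quotients coincide. *)
  have E : (fun h : R => h^-1 *: (((g : _ -> R^o) \o shift (c *: x)) (h *: (c *: delta_mx 0 i)) - g (c *: x))) =
     (fun h : R => h^-1 *: (((fun y => g (c *: y) : R^o) \o shift x) (h *: delta_mx 0 i) - g (c *: x))).
    apply/funext => h /=; congr (_ *: (g _ - _)).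
    by rewrite scalerDr !scalerA mulrC.
  by rewrite /derivable /derive => d1 d2; apply: DeriveDef; rewrite /derivable /derive -E.
have : is_derive x (delta_mx 0 i) (fun y => g (c *: y) : R^o)
    (c ^+ d.+1 * partial i g x).
  apply: (@near_eq_is_derive _ _ _ (c ^+ d.+1 \*: (g : _ -> R^o))).
    (* Homogeneity at [y] requires both [y] and [c *: y] in [U], which holds near [x] since [U] is
       open. *)
    have Uc : \forall y \near x, U (c *: y).
      have : c *: y @[y --> x] --> c *: x by exact: scaler_continuous.
      by apply; exact: open_nbhs_nbhs.
    near=> y; rewrite [RHS]hg //; near: y => //.
    exact: open_nbhs_nbhs.
  apply: is_deriveZ; apply: derivableP.
  by have [_ dg _] := (cont_diffSP _ _).1 cg; exact: dg.
move=> [_ e1]; have [_ e2] := dgc.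
move: e1; rewrite e2 exprS -mulrA => /mulfI; apply.
by rewrite gt_eqF.
Unshelve. all: by end_near. Qed.

Lemma homogeneous_iter_partial d g k : cont_diff (size k) U g ->
  homogeneous (size k + d) g -> homogeneous d (iter_partial k g).
Proof.
elim: k d => [//|i k IH] d /= cg hg; apply: homogeneous_partial.
  by apply: cont_diff_iter_partial; rewrite addn1.
apply: IH; first exact: cont_diff_leq cg.
by rewrite addnS.
Qed.

Lemma homogeneous_higher_diff d j g t : cont_diff j U g ->
  homogeneous (j + d) g -> homogeneous d (higher_diff j g ^~ t).
Proof.
move=> cg hg x c Ux c0 Ucx; rewrite /higher_diff mulr_sumr.
apply: eq_bigr => k _; rewrite mulrA; congr (_ * _).
by apply: homogeneous_iter_partial; rewrite ?size_tuple.
Qed.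

(** Euler's relation: near [s = 1] the function [g (s *: x)] is [s ^+ d * g x]; differentiate at 1.
    The summand 0 in the proof puts the ray in the form of [is_derive_line]. *)
Lemma homogeneous_is_derive d g x L : homogeneous d g -> U x ->
  is_derive x x (g : _ -> R^o) L -> L = d%:R * g x.
Proof.
move=> hg Ux dg.
have : is_derive (1 : R) (1 : R) (fun s : R => g (0 + s *: x) : R^o) L.
  by apply/is_derive_line; rewrite add0r scale1r.
have : is_derive (1 : R) (1 : R) (fun s : R => g (0 + s *: x) : R^o) (d%:R * g x).
  apply: (@near_eq_is_derive _ _ _ (g x \*: ((fun s : R => s ^+ d : R^o)))).
    have Us : \forall s \near (1 : R), U (s *: x).
      have : s *: x @[s --> (1 : R)] --> (1 : R) *: x by apply: cvgZr_tmp; exact: cvg_id.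
      by apply; rewrite scale1r; exact: open_nbhs_nbhs.
    near=> s; rewrite add0r [RHS]hg //; first by rewrite mulrC.
      by near: s; exact: lt_nbhsr.
    by near: s.
  have dX : is_derive (1 : R) (1 : R) (fun s : R => s ^+ d : R^o) (d%:R : R^o).
    apply: DeriveDef; first exact: exprn_derivable.
    by rewrite exp_derive expr1n /GRing.scale /= !mulr1.
  apply: (is_derive_eq (is_deriveZ (g x) dX)).
  by rewrite /GRing.scale /= mulrC.
by move=> [_ <-] [_ <-].
Unshelve. all: by end_near. Qed.

End ContDiff.

(** * Differentials of a homogeneous function along the line [a + t *: b] *)

Section TaylorHomogeneous.
Set Implicit Arguments.
Unset Strict Implicit.
Unset Printing Implicit Defensive.
Variables (R : realType) (n : nat) (U : set 'rV[R]_n).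
Hypothesis oU : open U.
Variables (m : nat) (F : 'rV[R]_n -> R) (a b : 'rV[R]_n).
Hypotheses (cF : cont_diff m U F) (hF : homogeneous U m F).

Let h := b - a.
(** The bound on [t] keeps [1 + t] positive, hence invertible; the set is open, so identities on it
    may be differentiated. *)
Let dom := [set t : R | -1 < t /\ U (a + t *: b)].

Lemma higher_diff_line_is_derive k t : (k < m)%N -> dom t ->
  is_derive t (1 : R) (fun s => higher_diff k F (a + s *: b) b : R^o)
    (higher_diff k.+1 F (a + t *: b) b).
Proof.
move=> km [_ Ut]; apply/(is_derive_line (fun x => higher_diff k F x b)).
rewrite higher_diffS; apply: higher_diff_is_derive Ut => //.
exact: cont_diff_leq cF.
Qed.

(* Since [(1 + t) *: b = (a + t *: b) + (b - a)], the derivative along [b] splits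
   into a radial part, given by Euler's relation, and one along [b - a]. *)
Lemma higher_diff_line_is_deriveB j t : (j < m)%N -> dom t ->
  is_derive t (1 : R) (fun s => higher_diff j F (a + s *: b) h : R^o)
    (((m - j)%:R * higher_diff j F (a + t *: b) h +
      higher_diff j.+1 F (a + t *: b) h) / (1 + t)).
Proof.
move=> jm [t1 Ut]; apply/(is_derive_line (fun x => higher_diff j F x h)).
have cj : cont_diff j.+1 U F by exact: cont_diff_leq cF.
set x := a + t *: b in Ut *.
have hj : homogeneous U (m - j) (higher_diff j F ^~ h).
  apply: homogeneous_higher_diff => //; first exact: cont_diff_leq (ltnW jm) cF.
  by rewrite subnKC // ltnW.
have <- := homogeneous_is_derive oU hj Ut (higher_diff_is_derive oU h x cj Ut).
rewrite higher_diffS.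
apply: is_derive_eq (higher_diff_is_derive oU h b cj Ut) _.
have t0 : 1 + t != 0 by rewrite gt_eqF// -ltrBlDl sub0r.
apply: (mulIf t0); rewrite divfK// -big_split mulr_suml /=.
apply: eq_bigr => i _; rewrite -mulrDl mulrAC; congr (_ * _).
by rewrite /x /h !mxE; ring.
Qed.

(** The coefficient of G_j in the expansion of (1 + t)^k A_k. The guard matters: for [j > k] the
    truncated [k - j] is 0 and the binomial would be 1 instead of 0. *)
Let w (k j : nat) : R :=
  if (j <= k)%N then 'C(m - j, k - j)%:R * k`!%:R / j`!%:R else 0.

(** The recurrence obtained by comparing coefficients of G_j when passing from [k] to [k.+1]. It
    combines Pascal's rule with the absorption identity [bpq]. *)
Let wS k j : (k < m)%N -> (j <= k.+1)%N ->
  w k.+1 j = w k j * ((m - j)%:R - k%:R) + (if j is j'.+1 then w k j' else 0).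
Proof.
have fact_neq0 i : i`!%:R != 0 :> R by rewrite pnatr_eq0 -lt0n fact_gt0.
rewrite /w => km; rewrite [X in is_true X -> _]leq_eqVlt => /predU1P[->|].
  rewrite /= !leqnn ltnn !subnn !bin0 mul0r add0r !mul1r !divff//.
rewrite ltnS => jk; rewrite jk leqW//.
(* With [p = m - j] and [q = k - j] the truncated subtractions disappear. *)
have [p [q [pq -> ->]]] : exists p q, [/\ (q < p)%N, m = (p + j)%N & k = (q + j)%N].
  by exists (m - j)%N, (k - j)%N; rewrite !subnK ?ltn_sub2r//; lia.
rewrite -addSn !addnK addSn.
have bpq : q.+1%:R * 'C(p, q.+1)%:R = (p%:R - q%:R) * 'C(p, q)%:R :> R.
  by rewrite -natrB ?(ltnW pq)// -!natrM mul_bin_left.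
have fS : ((q + j).+1)`!%:R = (q%:R + j%:R + 1) * (q + j)`!%:R :> R.
  by rewrite factS natrM -natr1 natrD.
rewrite fS natrD.
case: j {jk} fS => [|j] fS.
  rewrite !addr0 addn0 fact0 natr1 mulrA (mulrC _ q.+1%:R) bpq; ring.
rewrite ltnW; last by lia.
have -> : (p + j.+1 - j = p.+1)%N by lia.
have -> : (q + j.+1 - j = q.+1)%N by lia.
rewrite binS natrD factS natrM.
have q0 : (q.+1)%:R != 0 :> R by rewrite pnatr_eq0.
have j0 : (j.+1)%:R != 0 :> R by rewrite pnatr_eq0.
have -> : 'C(p, q.+1)%:R = (p%:R - q%:R) * 'C(p, q)%:R / q.+1%:R :> R.
  by rewrite -bpq mulrAC divff ?mul1r.
rewrite -(natr1 q) -(natr1 j) in q0 j0 *.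
by field; rewrite j0 q0 fact_neq0.
Qed.

(** Differentiate the identity for [k], multiply by [1 + t] and subtract [k] times the identity
    itself: this leaves (1 + t)^(k+1) A_(k+1) on the left. The statement ranges over all of [dom] so
    that it holds near [t] and can be differentiated. *)
Lemma higher_diff_line k t : (k <= m)%N -> dom t ->
  (1 + t) ^+ k * higher_diff k F (a + t *: b) b =
  \sum_(j < k.+1) w k j * higher_diff j F (a + t *: b) h.
Proof.
elim: k t => [|k IH] t km dt.
  by rewrite big_ord1 /w leqnn subnn bin0 fact0 !higher_diff0 expr0 divr1 !mul1r.
have t0 : 1 + t != 0 by case: dt => t1 _; rewrite gt_eqF// -ltrBlDl sub0r.
have near_dom : \forall s \near t, dom s.
  apply: filterI; first by apply: lt_nbhsr; case: dt.
  have : a + s *: b @[s --> t] --> a + t *: b.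
    by apply: cvgD; [exact: cvg_cst|apply: cvgZr_tmp; exact: cvg_id].
  by apply; apply: open_nbhs_nbhs; split=> //; case: dt.
pose A s : R^o := higher_diff k F (a + s *: b) b.
pose G j s : R^o := higher_diff j F (a + s *: b) h.
have dX : is_derive t (1 : R) (fun s : R => (1 + s) ^+ k : R^o)
    (k%:R * (1 + t) ^+ k.-1).
  have d1 : is_derive t (1 : R) (fun s : R => 1 + s : R^o) (1 : R).
    have := is_deriveD (is_derive_cst (1 : R^o) t (1 : R)) (is_derive_id t (1 : R)).
    by rewrite add0r.
  have -> : (fun s : R => (1 + s) ^+ k : R^o) = (fun s : R => 1 + s : R^o) ^+ k.
    by apply/funext => s; rewrite exprfctE.
  by apply: is_derive_eq (is_deriveX k d1) _; rewrite /GRing.scale /= mulr1.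
have dL := is_deriveM dX (higher_diff_line_is_derive km dt).
have dR : is_derive t (1 : R) (\sum_(j < k.+1) (w k j \*: G j))
    (\sum_(j < k.+1) w k j *: ((((m - j)%:R * G j t + G j.+1 t) / (1 + t)) : R^o)).
  apply: is_derive_sum => j; apply: is_deriveZ; apply: higher_diff_line_is_deriveB => //.
  exact: leq_trans (ltn_ord j) km.
(* Near [t] the sum equals the product differentiated in [dL], so it inherits that derivative;
   comparison with [dR] yields the equation [e2]. *)
have dLR : is_derive t (1 : R) (\sum_(j < k.+1) (w k j \*: G j))
   ((1 + t) ^+ k * higher_diff k.+1 F (a + t *: b) b + A t * (k%:R * (1 + t) ^+ k.-1)).
  apply: near_eq_is_derive dL; near=> s.
  rewrite fct_sumE /= -IH; [by [] | exact: ltnW | by near: s].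
have [_ e1] := dR; have [_ e2] := dLR; rewrite {}e1 in e2.
(* For [k = 0] the exponent [k.-1] is 0 rather than -1, but the factor [k] makes both sides
   vanish. *)
have kA : (1 + t) * (k%:R * (1 + t) ^+ k.-1 * A t) =
    k%:R * \sum_(j < k.+1) w k j * G j t.
  rewrite -IH ?(ltnW km)//; rewrite -/(A t); case: (k) => [|k']; first by rewrite !mul0r mulr0.
  by rewrite /= exprS; ring.
have -> : (1 + t) ^+ k.+1 * higher_diff k.+1 F (a + t *: b) b =
    \sum_(j < k.+1) w k j * (((m - j)%:R - k%:R) * G j t + G j.+1 t).
  transitivity ((1 + t) * (\sum_(j < k.+1) w k j *: ((((m - j)%:R * G j t + G j.+1 t) / (1 + t)) : R^o))
     - k%:R * \sum_(j < k.+1) w k j * G j t).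
    rewrite e2 -kA exprS; ring.
  rewrite !mulr_sumr -sumrB; apply: eq_bigr => j _.
  by rewrite /GRing.scale /=; field.
rewrite [RHS](eq_bigr (fun j : 'I_k.+2 =>
    w k j * ((m - j)%:R - k%:R) * G j t +
    (if (j : nat) is j'.+1 then w k j' else 0) * G j t)); last first.
  by move=> j _; rewrite wS ?mulrDl// -ltnS.
(* The first sum gains the index [k.+1] at no cost because its weight is 0; the second loses index 0
   and is shifted by one. *)
have wkk : w k k.+1 = 0 by rewrite /w ltnn.
rewrite big_split /= [X in _ = X + _]big_ord_recr /= wkk !mul0r addr0.
rewrite [X in _ = _ + X]big_ord_recl /= mul0r add0r -big_split /=.
by apply: eq_bigr => j _; rewrite mulrDr mulrA.
Unshelve. all: by end_near. Qed.

(** At [t = 0] and [k = m] the binomial in [w m j] is 1, leaving [m! / j!]; division by [m!] gives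
    exactly the Taylor coefficients. *)
Lemma taylor_homogeneous : U a ->
  taylor m F a (b - a) = (m`!)%:R^-1 * higher_diff m F a b.
Proof.
move=> Ua.
have := @higher_diff_line m 0 (leqnn m).
rewrite scale0r !addr0 expr1n mul1r => ->; last first.
  by split; [rewrite ltrN10|rewrite scale0r addr0].
rewrite /taylor big_add1 /= big_mkord big_ord_recl mulrDr; congr (_ + _).
  rewrite /w /= subn0 binn fact0 divr1 mul1r mulrA mulVf ?mul1r ?higher_diff0//.
rewrite mulr_sumr; apply: eq_bigr => i _.
rewrite /w /= /bump /= add1n ltn_ord binn mul1r !mulrA mulVf ?mul1r//.
Qed.

End TaylorHomogeneous.

Theorem corollary2 (R : realType) (n l : nat) (hn : (1 <= n)%N) (hl : (1 <= l)%N)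
  (U : set 'rV[R]_n) (hU : open U)
  (f : 'rV[R]_n -> R) (hom : pos_homogeneous1 U f) (hf : cont_diff l U f)
  (a b : 'rV[R]_n) (ha : U a) (hb : U b)
  (hab : [set (1 - t) *: a + t *: b | t in `[0, 1]] `<=` U)
  (m : nat) (hm : (1 <= m <= l)%N) :
  taylor m (fun x => f x ^+ m) a (b - a) =
  (m`!)%:R^-1 * higher_diff m (fun x => f x ^+ m) a b.
Proof.
have /andP[_ ml] := hm.
apply: (taylor_homogeneous hU) => //.
- by apply: cont_diffX => //; exact: (cont_diff_leq ml hf).
- exact: homogeneousX.
Qed.
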